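(* For every $n \in \mathbb{N}$ there exists $N \in \mathbb{N}$ such that $\tilde{\varphi}(m) > n$ for all $m\in\mathbb{N}$ with $m > N$.
   Context: $\mathbb{N}$ denotes the set of positive integers. For $n \in \mathbb{N}$, let $E_n = \{m \in \mathbb{N} : 1 \le m \le n,\ \gcd(m,n)=1,\ m \text{ is not a prime}\}$ and $\tilde{\varphi}(n) = |E_n|$ (note that $1$ is not a prime). *)

(* Defs.v *)
From mathcomp Require Import all_boot.

Set Implicit Arguments.
Unset Strict Implicit.
Unset Printing Implicit Defensive.

(* The ambient type 'I_n.+1 is {0, ..., n}, so that m = n is allowed (it only
   matters for n = 1, where the set is {1}). *)
Definition nonprime_totatives (n : nat) : {set 'I_n.+1} :=
  [set m : 'I_n.+1 | [&& 1 <= m, m <= n, coprime m n & ~~ prime m]].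

Definition nonprime_totient (n : nat) : nat := #|nonprime_totatives n|.

(* Main.v *)
Require Import Defs.
From mathcomp Require Import all_boot.
From mathcomp Require Import zify.

(** An integer [m] that misses a prime [p] with [p ^ (n + 2) <= m] has the
    [n + 1] nonprime totatives [p ^ 2, ..., p ^ (n + 2)].  So it is enough that
    every large [m] misses such a small prime ([small_prime_not_dvd]).

    Put [c = n + 2] and choose [a] with [2 ^ (a * c) <= m < 2 ^ (a.+1 * c)], and
    suppose that all primes up to [x = 2 ^ a] divide [m].  As [m] has at most
    [log2 m] prime factors, [pi(x) < a.+1 * c], which is polynomial in
    [a = log2 x].  But primes are much denser: a weak Chebyshev bound
    [2 ^ (x - 1) <= x ^ pi(x)] ([chebyshev_lower_bound]) forces
    [2 ^ a - 1 <= a * pi(x)], which fails for large [a].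

    The Chebyshev bound is obtained from a common multiple [L <= x ^ pi(x)] of
    [1, ..., x]: the Leibniz harmonic triangle shows that [L] is a multiple of
    every [x * 'C(x - 1, j)] ([dvdn_mul_bin]), and the binomial coefficients
    ['C(x - 1, j)] have mean [2 ^ (x - 1) / x]. *)

(** The numbers [1 / (j * 'C(k, j))] form the Leibniz triangle, in which
    [1 / (j * 'C(k, j)) + 1 / (j.+1 * 'C(k, j.+1)) = 1 / (j * 'C(k.-1, j))].
    Multiplied by [L], the first entry [1 / k] of each row is an integer, hence
    so is every entry, by induction on [j]. *)
Lemma dvdn_mul_bin L k j :
    (forall i, 0 < i <= k -> i %| L) -> 0 < j <= k -> j * 'C(k, j) %| L.
Proof.
elim: j k => [//|[|j] IHj] k Lk.
  by move=> k_gt0; rewrite mul1n bin1; apply: Lk; lia.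
case: k Lk => // k Lk /andP[_]; rewrite ltnS => ltjk.
have /dvdnP[u Lu] : j.+1 * 'C(k.+1, j.+1) %| L by apply: IHj => //; lia.
have /dvdnP[v Lv] : j.+1 * 'C(k, j.+1) %| L.
  by apply: IHj => // i Hi; apply: Lk; lia.
(* With [L] cleared, the triangle identity says that the next quotient is
   [v - u]; this relation between [u] and [v] is what makes it so. *)
have Euv : u * k.+1 = v * (k - j).
  apply/eqP; rewrite -(@eqn_pmul2r 'C(k, j)) ?bin_gt0 1?ltnW //.
  by rewrite -!mulnA -mul_bin_left mul_bin_diag -Lu -Lv.
apply/dvdnP; exists (v - u); rewrite -mul_bin_diag mulnA mulnBl Euv -mulnBr.
by rewrite Lv mulnA; congr (_ * _ * _); lia.
Qed.

(** Each of the [k.+1] binomial coefficients ['C(k, j)], of sum [2 ^ k], satisfies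
    [k.+1 * 'C(k, j) <= L] by divisibility. *)
Lemma leq_common_multiple L k :
  0 < L -> (forall i, 0 < i <= k.+1 -> i %| L) -> 2 ^ k <= L.
Proof.
move=> L_gt0 Lk; rewrite -(@leq_pmul2l k.+1) // -[2]/(1 + 1) expnDn big_distrr /=.
rewrite -[k.+1 in leqRHS]card_ord -sum_nat_const; apply: leq_sum => j _.
rewrite !exp1n !muln1 mul_bin_diag dvdn_leq //.
by apply: dvdn_mul_bin => //; exact: ltn_ord.
Qed.

Definition primes_upto (x : nat) : seq nat := [seq p <- iota 0 x.+1 | prime p].

Lemma mem_primes_upto x p : (p \in primes_upto x) = prime p && (p <= x).
Proof. by rewrite mem_filter mem_iota. Qed.

(** The product [L] below is the least common multiple of [1, ..., k.+1], and each
    of its factors [p ^ trunc_log p k.+1] is at most [k.+1]. *)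
Lemma chebyshev_lower_bound k : 2 ^ k <= k.+1 ^ size (primes_upto k.+1).
Proof.
set s := primes_upto _; pose L := \prod_(p <- s) p ^ trunc_log p k.+1.
have s_prime p : p \in s -> prime p by rewrite mem_primes_upto => /andP[].
have le_L : L <= k.+1 ^ size s.
  rewrite -iter_muln_1 -[size s]count_predT -big_const_seq /L.
  rewrite big_seq [leqRHS]big_seq.
  by apply: leq_prod => p /s_prime/prime_gt1 p_gt1; apply: trunc_logP.
apply: leq_trans le_L; apply: leq_common_multiple => [|i /andP[i_gt0 le_ik]].
  rewrite /L big_seq prodn_cond_gt0 // => p /s_prime/prime_gt0.
  by rewrite expn_gt0 => ->.
apply/dvdn_partP => // p; rewrite mem_primes i_gt0 => /and3P[p_pr _ p_i].
have p_s : p \in s by rewrite mem_primes_upto p_pr (leq_trans (dvdn_leq _ p_i)).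
rewrite p_part /L (big_rem p) //= dvdn_mulr // dvdn_exp2l //.
apply: trunc_log_max; first exact: prime_gt1.
by apply: leq_trans le_ik; rewrite dvdn_leq ?pfactor_dvdnn.
Qed.

Lemma exp2_size_primes m : 0 < m -> 2 ^ size (primes m) <= m.
Proof.
move=> m_gt0; rewrite {2}[m]prod_prime_decomp // /primes size_map.
have := @mem_prime_decomp m.
elim: (prime_decomp m) => [|[p e] s IHs] Hs; first by rewrite big_nil.
have [p_pr e_gt0 _] := Hs p e (mem_head _ _).
rewrite big_cons expnS leq_mul //=; last first.
  by apply: IHs => q f qs; apply: Hs; rewrite inE qs orbT.
apply: leq_trans (prime_gt1 p_pr) _.
by rewrite -{1}(expn1 p) leq_pexp2l ?(prime_gt0 p_pr).
Qed.

Lemma cube_lt_exp2 a : 11 <= a -> a.+1 ^ 3 < 2 ^ a.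
Proof.
elim: a => // a IHa; rewrite leq_eqVlt => /predU1P[[<-]//|le_a].
have := IHa le_a; rewrite (expnS 2) !expnS !expn0 !muln1.
by move: (2 ^ a) => y; nia.
Qed.

(** The lower bound on [m] yields [c + 11 <= a] for the [a] below: [c <= a] turns
    the quadratic bound [a * (a.+1 * c)] into the cubic one of [cube_lt_exp2],
    which holds from [11] on. *)
Lemma small_prime_not_dvd c m : 0 < c -> 2 ^ ((c + 11) * c) <= m ->
  exists p, [/\ prime p, ~~ (p %| m) & p ^ c <= m].
Proof.
move=> c_gt0 le_m; have m_gt0 : 0 < m by apply: leq_trans le_m; rewrite expn_gt0.
pose a := trunc_log 2 m %/ c.
have le_a : c + 11 <= a by rewrite leq_divRL // trunc_log_max.
have le_am : 2 ^ (a * c) <= m.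
  apply: leq_trans (@trunc_logP 2 m isT m_gt0).
  by rewrite leq_pexp2l // leq_divM.
have lt_ma : m < 2 ^ (a.+1 * c).
  apply: leq_trans (@trunc_log_ltn 2 m isT) _.
  by rewrite leq_pexp2l // ltn_ceil.
have [all_dvd|] := boolP (all (dvdn^~ m) (primes_upto (2 ^ a))); last first.
  case/allPn=> p; rewrite mem_primes_upto => /andP[p_pr le_pa] p_ndvd.
  by exists p; split=> //; rewrite (leq_trans _ le_am) // expnM leq_exp2r.
have le_pi : size (primes_upto (2 ^ a)) < a.+1 * c.
  rewrite -(@ltn_exp2l 2) //; apply: leq_ltn_trans lt_ma.
  apply: leq_trans (exp2_size_primes m m_gt0); rewrite leq_pexp2l //.
  apply: uniq_leq_size; first by rewrite filter_uniq ?iota_uniq.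
  move=> p p_s; have p_m := allP all_dvd p p_s.
  by move: p_s; rewrite mem_primes_upto mem_primes m_gt0 p_m !andbT => /andP[].
have := chebyshev_lower_bound (2 ^ a).-1.
rewrite prednK ?expn_gt0 // -expnM leq_exp2l // => le_cheb.
have := cube_lt_exp2 a (leq_trans (leq_addl _ _) le_a).
rewrite ltnNge => /negP[].
have le_c : a.+1 * c <= a.+1 * a.
  by rewrite leq_mul2l (leq_trans (leq_addr _ _) le_a).
have le_k := leq_trans (ltnW le_pi) le_c.
have le_y : (2 ^ a).-1 <= a * (a.+1 * a).
  by rewrite (leq_trans le_cheb) ?leq_mul2l ?le_k ?orbT.
rewrite !expnS expn0 muln1; move: (2 ^ a) le_y => y le_y; nia.
Qed.

Theorem theorem2 (n : nat) (hn : 0 < n) :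
  exists N : nat, 0 < N /\
    forall m : nat, 0 < m -> N < m -> n < nonprime_totient m.
Proof.
exists (2 ^ ((n.+2 + 11) * n.+2)).
split=> [|m m_gt0 lt_m]; first by rewrite expn_gt0.
have [p [p_pr p_ndvd le_pm]] := small_prime_not_dvd n.+2 m isT (ltnW lt_m).
have le_pow (i : 'I_n.+1) : p ^ i.+2 <= m.
  by rewrite (leq_trans _ le_pm) // leq_pexp2l ?(prime_gt0 p_pr) // ltnS ltn_ord.
pose f (i : 'I_n.+1) : 'I_m.+1 := inord (p ^ i.+2).
have f_val i : f i = p ^ i.+2 :> nat by rewrite inordK // ltnS.
have f_inj : injective f.
  move=> i j /(congr1 val) /=; rewrite !f_val => /eqP.
  by rewrite eqn_exp2l ?prime_gt1 // => /eqP[] /val_inj.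
rewrite -[n.+1]card_ord -(card_imset _ f_inj) subset_leq_card //.
apply/subsetP=> _ /imsetP[i _ ->]; rewrite inE f_val expn_gt0 prime_gt0 //=.
rewrite le_pow coprimeXl ?prime_coprime //=.
apply/primePns; right; exists p; split=> //; last by rewrite dvdn_exp.
by rewrite leq_pexp2l ?prime_gt0.
Qed.
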